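(* Let $\gamma_0\in Y$, $\gamma_0:[a,b]\to\mathbb{R}^2$, and let $\gamma_n=\varphi^n(\gamma_0)$ for $n\ge 0$; write $\gamma_n(t)=(x_n(t),y_n(t))$, $t\in[a,b]$. Assume that for every $n\ge 0$ the curve $\gamma_n$ is the graph of a smooth function, i.e. there is a smooth function $f_n:[0,1]\to\mathbb{R}$ such that $y_n(t)=f_n(x_n(t))$ for all $t\in[a,b]$ (in particular $x_n(t)\in[0,1]$). Then for all $n\ge 0$ the function $f_n$ is identically zero. In other words, if the image of $\gamma_0$ is not the straight segment from $(0,0)$ to $(1,0)$, then the curves $\gamma_n$ cannot all be graphs of smooth functions $f_n:[0,1]\to\mathbb{R}$.
   Context: Smooth means $C^\infty$. $Y$ is the set of smooth immersed curves $\gamma:[a,b]\to\mathbb{R}^2$ (with $a<b$; self-intersections allowed) such that: $\gamma(a)=(0,0)$ and $\gamma(b)=(1,0)$; with respect to the arc length parameter, the first derivative of $\gamma$ at both endpoints equals $(1,0)$; and with respect to the arc length parameter, all derivatives of $\gamma$ of order $\ge 2$ vanish at both endpoints. The map $\varphi:Y\to Y$ is defined by $\varphi(\gamma)(t)=\gamma(t)+\frac{\dot\gamma(t)}{\|\dot\gamma(t)\|}-(1,0)$, so $\varphi(\gamma)$ is parametrized by the same interval as $\gamma$; $\varphi^n$ denotes the $n$-fold iterate. *)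

(* Defs.v *)
From mathcomp Require Import all_boot all_order all_algebra.
From mathcomp Require Import all_classical all_reals all_analysis.

Set Implicit Arguments.
Unset Strict Implicit.
Unset Printing Implicit Defensive.

Import Order.TTheory GRing.Theory Num.Theory.
Import numFieldNormedType.Exports.

Local Open Scope classical_set_scope.
Local Open Scope ring_scope.

(* A map defined on a closed interval [a, b] is represented by a total function
   on R, of which only the values on [a, b] matter: all the limits below are
   taken inside [a, b], so that derivatives are one-sided at a and at b. *)

Definition dquot_in (R : realType) (V : normedModType R) (a b : R)
    (f : R -> V) (t : R) : set_system V :=
  (fun s => (s - t)^-1 *: (f s - f t)) @ within `[a, b] t^'.

Definition derive_in (R : realType) (V : normedModType R) (a b : R)
    (f : R -> V) (t : R) : V :=
  lim (dquot_in a b f t).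

Definition derive_inn (R : realType) (V : normedModType R) (a b : R) (k : nat)
    (f : R -> V) : R -> V :=
  iter k (derive_in a b) f.

Definition smooth_in (R : realType) (V : normedModType R) (a b : R)
    (f : R -> V) : Prop :=
  forall (k : nat) (t : R), t \in `[a, b] ->
    cvg (dquot_in a b (derive_inn a b k f) t).

(* The library norm on R * R is the sup norm, hence this definition. *)
Definition enorm (R : realType) (p : R * R) : R :=
  Num.sqrt (p.1 ^+ 2 + p.2 ^+ 2).

Definition immersed (R : realType) (a b : R) (g : R -> R * R) : Prop :=
  smooth_in a b g /\
  forall t : R, t \in `[a, b] -> derive_in a b g t != 0.

Definition arclen (R : realType) (a b : R) (g : R -> R * R) (t : R) : R :=
  \int[lebesgue_measure]_(u in `[a, t]) enorm (derive_in a b g u).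

(* For g immersed, arclen a b g is a bijection from [a, b] onto
   [0, arclen a b g b]; arcparam a b g is g composed with its inverse. *)
Definition arcparam (R : realType) (a b : R) (g : R -> R * R) : R -> R * R :=
  g \o 'pinv_(fun=> a) `[a, b] (arclen a b g).

Definition derive_arc (R : realType) (a b : R) (k : nat) (g : R -> R * R)
    : R -> R * R :=
  derive_inn 0 (arclen a b g b) k (arcparam a b g).

Record inY (R : realType) (a b : R) (g : R -> R * R) : Prop := InY {
  inY_lt : a < b;
  inY_immersed : immersed a b g;
  inY_start : g a = (0, 0);
  inY_end : g b = (1, 0);
  inY_tangent_start : derive_arc a b 1 g 0 = (1, 0);
  inY_tangent_end : derive_arc a b 1 g (arclen a b g b) = (1, 0);
  inY_flat_start : forall k : nat, (2 <= k)%N -> derive_arc a b k g 0 = 0;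
  inY_flat_end : forall k : nat, (2 <= k)%N ->
    derive_arc a b k g (arclen a b g b) = 0 }.

Definition phi (R : realType) (a b : R) (g : R -> R * R) : R -> R * R :=
  fun t => g t + (enorm (derive_in a b g t))^-1 *: derive_in a b g t - (1, 0).

Definition is_smooth_graph (R : realType) (a b : R) (g : R -> R * R)
    (f : R -> R) : Prop :=
  smooth_in 0 1 f /\
  forall t : R, t \in `[a, b] ->
    (g t).1 \in `[0, 1] /\ (g t).2 = f (g t).1.

Definition segment01 {R : realType} : set (R * R) :=
  [set (x, 0) | x in `[0, 1]].

(* Main.v *)
Require Import Defs.
From mathcomp Require Import all_boot all_order all_algebra.
From mathcomp Require Import all_classical all_reals all_analysis.
From mathcomp Require Import ring lra.

Import Order.TTheory GRing.Theory Num.Theory.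
Import numFieldNormedType.Exports.

Local Open Scope classical_set_scope.
Local Open Scope ring_scope.

(** Let [(K_n, S_n)] be the unit tangent of the curve [(x_n, y_n)], so that [phi]
    adds [K_n - 1] to [x_n] and [S_n] to [y_n]. If all the curves are graphs, then
    [K_n > 0] and [0 <= x_n <= 1], and the decreasing sequence [x_n(t)] loses at most
    1 in total. Therefore [sum (1 - K_n(t)) <= 1], the tangents become horizontal
    on average, and [y_n(t)] grows slowly with [n] ([height_linear_growth]).

    On the other hand [y_n] is recovered from [y_(n+1)] by an integration, since
    [dy_n / ds_n = S_n = y_(n+1) - y_n]; repeated integration from the common
    starting point, where all the curves have height 0, should bring any slowly
    growing family of heights down to 0. The precise form is a maximum principle:
    for every [d > 0],
      [e^(4 y_n) < 1 + d 3^n e^(4 x_n)] on [[a, b]].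
    This is true for large [n] by the slow growth, and it passes from [n + 1] to [n]
    ([barrier_step]): at a maximum of [e^(4 y_n) - d 3^n e^(4 x_n)] that reaches 1,
    the sign of the derivative and the bound at level [n + 1] would make both [K_n] and
    [S_n] at most [1/2]. Letting [d] tend to 0 gives [y_0 <= 0] ([height_le0]), and by
    reflection [y_0 = 0]; the same holds for every iterate. Horizontal curves are
    fixed by [phi], and [x_0] runs over all of [[0, 1]], which gives both claims.

    The argument uses that every iterate starts at the origin. The shift of the
    starting point from one curve to the next depends on its tangent there, the
    tangent of the next curve on the curvature, and so on, so all the derivatives at
    [a] are involved. The functions flat at [a] form an ideal stable under
    derivation, and [phi] preserves the property that the velocity is [(1, 0)] plus
    flat functions ([flat_start_phi]). The hypotheses on [g0] give this property for
    the arc length parametrization ([arcparam_flat_start]), and [phi] commutes with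
    the change of parameter ([iter_phi_arcparam]). *)

(** * Derivatives relative to a set *)

Section DerivativeWithin.
Set Implicit Arguments.
Unset Strict Implicit.
Context {R : realType}.
Implicit Types (A B : set R) (f g h : R -> R) (t l m : R).

(** Derivatives relative to a set, so that one chain rule serves segments with
    their one-sided derivatives, changes of parameter and functions on the line. *)
Definition has_deriv A f t l :=
  (fun s => (s - t)^-1 * (f s - f t)) @ within A t^' --> l.

Lemma within_dnbhs_neq A t : \forall s \near within A t^', s != t.
Proof. exact: (@cvg_within _ _ _ A _ (nbhs_dnbhs_neq t)). Qed.

Lemma has_deriv_ext A f g t l : A t -> (forall s, A s -> f s = g s) ->
  has_deriv A f t l -> has_deriv A g t l.
Proof.
move=> At fg; apply: cvg_trans; apply: near_eq_cvg.
by near=> s; rewrite !fg//; near: s; exact: withinT.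
Unshelve. all: by end_near. Qed.

Lemma has_deriv_sub A B f t l : A `<=` B ->
  has_deriv B f t l -> has_deriv A f t l.
Proof.
move=> AB df U /df; rewrite /= /nbhs /= /within /= /dnbhs /within /=.
by apply: (@filterS _ (nbhs t)) => s + st As; apply => //; exact: AB.
Qed.

Lemma has_deriv_cst A c t : has_deriv A (fun=> c) t 0.
Proof.
rewrite /has_deriv; under eq_fun do rewrite subrr mulr0.
exact: cvg_cst.
Qed.

Lemma has_derivD A f g t l m : has_deriv A f t l -> has_deriv A g t m ->
  has_deriv A (fun s => f s + g s) t (l + m).
Proof.
move=> df dg; rewrite /has_deriv.
under eq_fun do rewrite opprD addrACA mulrDr.
exact: cvgD df dg.
Qed.

Lemma within_dnbhs_nbhs A f t (y : R) : f @ within A t^' --> y -> f t = y ->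
  f @ within A (nbhs t) --> y.
Proof.
move=> fy fty U Uy; rewrite /= /nbhs /= /within /=.
have := fy U Uy; rewrite /= /nbhs/= /within /= /dnbhs /within /=.
apply: (@filterS _ (nbhs t)) => s Us As; have [->|/eqP st] := eqVneq s t.
  by rewrite /= fty; exact: nbhs_singleton.
exact: Us (introN eqP st) As.
Qed.

Lemma within_nbhs_dnbhs A f t (y : R) :
  f @ within A (nbhs t) --> y -> f @ within A t^' --> y.
Proof.
move=> fy U /fy; rewrite /= /nbhs /= /within /= /dnbhs /within /=.
by apply: (@filterS _ (nbhs t)) => s + _.
Qed.

Lemma has_deriv_cvg A f t l : has_deriv A f t l ->
  f @ within A (nbhs t) --> f t.
Proof.
move=> df; apply: within_dnbhs_nbhs => //.
have idt : (fun s : R => s) @ within A t^' --> t.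
  move=> U Ut; rewrite /= /nbhs /= /within /= /dnbhs /within /=.
  by apply: (@filterS _ (nbhs t)) Ut.
have h : (fun s => f t + (s - t) * ((s - t)^-1 * (f s - f t)))
    @ within A t^' --> f t + (t - t) * l.
  apply: cvgD; first exact: cvg_cst.
  by apply: cvgM => //; apply: cvgB => //; exact: cvg_cst.
rewrite subrr mul0r addr0 in h.
apply: cvg_trans h; apply: near_eq_cvg.
near=> s; rewrite mulVKf ?subrKC// subr_eq0.
by near: s; exact: within_dnbhs_neq.
Unshelve. all: by end_near. Qed.

Lemma has_derivM A f g t l m : has_deriv A f t l -> has_deriv A g t m ->
  has_deriv A (fun s => f s * g s) t (l * g t + f t * m).
Proof.
move=> df dg; rewrite /has_deriv.
have -> : (fun s => (s - t)^-1 * (f s * g s - f t * g t)) =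
    (fun s => (s - t)^-1 * (f s - f t) * g s + f t * ((s - t)^-1 * (g s - g t))).
  by apply/funext => s; ring.
apply: cvgD; last by apply: cvgM dg; exact: cvg_cst.
apply: cvgM => //.
by apply: within_nbhs_dnbhs; exact: has_deriv_cvg dg.
Qed.

(** Caratheodory's slope [w] of [h] at [f t] turns the difference quotient of
    [h \o f] into a product, also where [f s = f t]. *)
Lemma has_deriv_comp A B f h t l m : (forall s, A s -> B (f s)) ->
  has_deriv A f t l -> has_deriv B h (f t) m ->
  has_deriv A (h \o f) t (m * l).
Proof.
move=> AB df dh; pose w y := if y == f t then m
  else (y - f t)^-1 * (h y - h (f t)).
have wE y : h y - h (f t) = w y * (y - f t).
  rewrite /w; have [->|ne] := eqVneq y (f t); first by rewrite !subrr mulr0.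
  by rewrite mulrAC mulVf ?mul1r// subr_eq0.
have cw : w @ within B (nbhs (f t)) --> m.
  apply: within_dnbhs_nbhs; last by rewrite /w eqxx.
  apply: cvg_trans dh; apply: near_eq_cvg; near=> y.
  have -> : w y = (y - f t)^-1 * (h y - h (f t)) => //.
  rewrite /w ifF//; apply/negbTE.
  by near: y; exact: within_dnbhs_neq.
have cwf : (w \o f) @ within A t^' --> m.
  move=> U /cw; rewrite /= /nbhs /= {1}/within /= => nU.
  have := has_deriv_cvg df nU; rewrite /= /nbhs /= /within /dnbhs /within /=.
  by apply: (@filterS _ (nbhs t)) => s + _ As => /(_ As); apply; exact: AB.
rewrite /has_deriv; have -> : (fun s => (s - t)^-1 * ((h \o f) s - (h \o f) t)) =
    (fun s => (w \o f) s * ((s - t)^-1 * (f s - f t))).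
  by apply/funext => s; rewrite /= wE; ring.
exact: cvgM.
Unshelve. all: by end_near. Qed.

Lemma is_derive_has_deriv A h t m : is_derive t (1 : R) h m -> has_deriv A h t m.
Proof.
move=> /is_derive1_caratheodory[w [hw cw wt]].
apply: (@cvg_trans _ (w @ within A t^')); last first.
  by rewrite -wt; apply: within_nbhs_dnbhs; apply: cvg_within_filter.
apply: near_eq_cvg; near=> s; rewrite hw mulrC mulfK// subr_eq0.
by near: s; exact: within_dnbhs_neq.
Unshelve. all: by end_near. Qed.

Lemma has_deriv_unique A f t l m : ProperFilter (within A t^') ->
  has_deriv A f t l -> has_deriv A f t m -> l = m.
Proof. by move=> PF; exact: cvg_unique. Qed.

End DerivativeWithin.

(** * Smooth and flat functions on a segment *)

Section DerivativeOnSegment.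
Set Implicit Arguments.
Unset Strict Implicit.
Context {R : realType}.
Variables (a b : R).
Hypothesis ab : a < b.
Implicit Types (f : R -> R) (g : R -> R * R) (t l : R).

Local Notation D := (has_deriv `[a, b]).

Lemma within_itv_proper t : t \in `[a, b] -> ProperFilter (within `[a, b] t^').
Proof.
move=> tab; apply: Build_ProperFilter_ex => P.
rewrite /within /dnbhs /within /= => /nbhs_ballP[e /= e0 eP].
have [tb|bt] := ltP t b.
- have m0 : 0 < Num.min (e / 2) (b - t) by rewrite lt_min divr_gt0//= subr_gt0.
  exists (t + Num.min (e / 2) (b - t)); apply: eP.
  + rewrite /ball/= opprD addNKr normrN gtr0_norm//.
    by rewrite gt_min ltr_pdivrMr// ltr_pMr// ltr1n.
  + by rewrite gt_eqF// ltrDl.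
  + move: tab; rewrite !in_itv/= => /andP[at_ _]; apply/andP; split.
      by rewrite (le_trans at_)// lerDl ltW.
    by rewrite -lerBrDl ge_min lexx orbT.
- have bE : t = b by apply/eqP; rewrite eq_le bt (itvP tab).
  have m0 : 0 < Num.min (e / 2) (b - a) by rewrite lt_min divr_gt0//= subr_gt0.
  exists (t - Num.min (e / 2) (b - a)); apply: eP.
  + rewrite /ball/= opprB addrC subrK gtr0_norm//.
    by rewrite gt_min ltr_pdivrMr// ltr_pMr// ltr1n.
  + by rewrite lt_eqF// ltrBlDr ltrDl.
  + rewrite bE in_itv/= lerBlDr lerDl (ltW m0) andbT.
    by rewrite lerBrDr -lerBrDl ge_min lexx orbT.
Qed.

Lemma has_deriv_itv_unique f t l m : t \in `[a, b] -> D f t l -> D f t m -> l = m.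
Proof. by move=> /within_itv_proper; exact: has_deriv_unique. Qed.

Lemma has_deriv_continuous f (f' : R -> R) :
  (forall t, t \in `[a, b] -> D f t (f' t)) -> {within `[a, b], continuous f}.
Proof.
by move=> df; apply/subspace_continuousP => t /df; exact: has_deriv_cvg.
Qed.

Lemma cvg_dquot_has_deriv g t : t \in `[a, b] -> cvg (dquot_in a b g t) ->
  D (fst \o g) t (derive_in a b g t).1 /\ D (snd \o g) t (derive_in a b g t).2.
Proof.
move=> /within_itv_proper PF /cvgP cg; split.
  exact: (cvg_comp _ _ cg cvg_fst).
exact: (cvg_comp _ _ cg cvg_snd).
Qed.

Lemma has_deriv_cvg_dquot g t p q : t \in `[a, b] ->
  D (fst \o g) t p -> D (snd \o g) t q -> dquot_in a b g t --> (p, q).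
Proof.
move=> /within_itv_proper PF dp dq.
have -> : dquot_in a b g t =
  (fun s => ((s - t)^-1 * ((fst \o g) s - (fst \o g) t),
             (s - t)^-1 * ((snd \o g) s - (snd \o g) t))) @ within `[a, b] t^'.
  by [].
exact: (@cvg_pair _ _ _ (within `[a, b] t^') (nbhs p) (nbhs q)).
Qed.

Lemma has_deriv_derive_in_pair g t p q : t \in `[a, b] ->
  D (fst \o g) t p -> D (snd \o g) t q -> derive_in a b g t = (p, q).
Proof.
move=> tab dp dq; have PF := within_itv_proper tab.
by apply/cvg_lim; [exact: norm_hausdorff | exact: has_deriv_cvg_dquot].
Qed.

(** [f] has [k] derivatives on [[a, b]], and [f] and these derivatives vanish at [a]
    when [flat]. One predicate covers smooth functions ([flat = false], every [k])
    and functions flat at [a]; the derivative is existential, so that closure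
    properties do not depend on values outside [[a, b]]. *)
Fixpoint jet (flat : bool) (k : nat) f : Prop := (flat -> f a = 0) /\
  match k with
  | 0 => True
  | k'.+1 => exists2 f', (forall t, t \in `[a, b] -> D f t (f' t)) & jet flat k' f'
  end.

Lemma jet0 flat k f : jet flat k f -> flat -> f a = 0.
Proof. by case: k => [|k] []. Qed.

Lemma jetW flat k f : jet flat k.+1 f -> jet flat k f.
Proof.
elim: k f => [|k IH] f; first by case.
by move=> -[f0 [f' df /IH jf']]; split => //; exists f'.
Qed.

Lemma jet_ext flat k f f2 : (forall t, t \in `[a, b] -> f t = f2 t) ->
  jet flat k f -> jet flat k f2.
Proof.
move=> ff2; have aI : a \in `[a, b] by rewrite in_itv/= lexx ltW.
case: k => [|k] /= [f0]; first by split => // /f0; rewrite ff2.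
move=> [f' df jf']; split; first by move=> /f0; rewrite ff2.
by exists f' => // t tab; apply: has_deriv_ext (df _ tab).
Qed.

Lemma jet_cst k c : jet false k (fun=> c).
Proof.
elim: k c => [|k IH] c //=; split => //; exists (fun=> 0) => //.
by move=> t _; exact: has_deriv_cst.
Qed.

Lemma jet_weak flat k f : jet flat k f -> jet false k f.
Proof.
elim: k f => [|k IH] f; first by case.
by move=> -[_ [f' df /IH jf']]; split => //; exists f'.
Qed.

Lemma jetD flat k f f2 : jet flat k f -> jet flat k f2 ->
  jet flat k (fun s => f s + f2 s).
Proof.
elim: k f f2 => [|k IH] f f2.
  by move=> [f0 _] [g0 _]; split => // z; rewrite f0// g0// addr0.
move=> [f0 [f' df jf']] [g0 [g' dg jg']]; split.
  by move=> z; rewrite f0// g0// addr0.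
exists (fun s => f' s + g' s); last exact: IH.
by move=> t tab; apply: has_derivD; [exact: df|exact: dg].
Qed.

(** By Leibniz' rule the functions flat at [a] form an ideal among the smooth ones. *)
Lemma jetM flat k f f2 : jet flat k f -> jet false k f2 ->
  jet flat k (fun s => f s * f2 s).
Proof.
elim: k f f2 => [|k IH] f f2.
  by move=> [f0 _] _; split => // z; rewrite f0// mul0r.
move=> jf jf2; move: (jf) (jf2) => [f0 [f' df jf']] [g0 [g' dg jg']]; split.
  by move=> z; rewrite f0// mul0r.
exists (fun s => f' s * f2 s + f s * g' s).
  by move=> t tab; apply: has_derivM; [exact: df|exact: dg].
by apply: jetD; apply: IH => //; exact: jetW.
Qed.

Lemma jetMl flat k f f2 : jet false k f -> jet flat k f2 ->
  jet flat k (fun s => f s * f2 s).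
Proof.
move=> jf jf2; apply: jet_ext (jetM jf2 jf) => t _; exact: mulrC.
Qed.

Lemma jetDc k f c : jet false k (fun s => f s - c) -> jet false k f.
Proof.
move=> jf; apply: jet_ext (jetD jf (jet_cst k c)) => t _; exact: subrK.
Qed.

(** Uniqueness of derivatives makes one function serve every order [k]. *)
Lemma jet_deriv flat f : (forall k, jet flat k f) ->
  exists2 f', (forall t, t \in `[a, b] -> D f t (f' t)) & forall k, jet flat k f'.
Proof.
move=> jf; have [_ [f' df _]] := jf 1%N; exists f' => // k.
have [_ [h dh jh]] := jf k.+1; apply: jet_ext jh => t tab.
exact: has_deriv_itv_unique (dh _ tab) (df _ tab).
Qed.

End DerivativeOnSegment.

(** * The unit tangent, and curves that start flat *)

Section UnitTangent.
Set Implicit Arguments.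
Unset Strict Implicit.
Context {R : realType}.
Variables (a b : R).
Hypothesis ab : a < b.
Implicit Types (f p q : R -> R) (g : R -> R * R) (t l : R).

Local Notation D := (has_deriv `[a, b]).
Local Notation jet := (@jet R a b).

Lemma is_derive_invsqrt (z : R) : 0 < z ->
  is_derive z (1 : R) (fun x => (Num.sqrt x)^-1) (- 2^-1 * (Num.sqrt z)^-1 ^+ 3).
Proof.
move=> z0; have s0 : Num.sqrt z != 0 by rewrite gt_eqF// sqrtr_gt0.
have ds := is_derive1_sqrt z0.
have := is_deriveV (f := Num.sqrt) (v := 1) s0. move=> H; apply: (is_derive_eq (H _ ds)).
by rewrite /GRing.scale /=; field.
Qed.

Lemma enorm_gt0 (u : R * R) : u != 0 -> 0 < enorm u.
Proof.
case: u => x y n0; rewrite sqrtr_gt0 /= lt_neqAle addr_ge0 ?sqr_ge0// andbT.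
by rewrite eq_sym paddr_eq0 ?sqr_ge0// !sqrf_eq0 -xpair_eqE.
Qed.

Lemma has_deriv_inv_enorm p q (p' q' : R -> R) t : (p t, q t) != 0 ->
  D p t (p' t) -> D q t (q' t) ->
  D (fun s => (enorm (p s, q s))^-1) t
    (- ((enorm (p t, q t))^-1 * ((enorm (p t, q t))^-1 * (enorm (p t, q t))^-1)
        * (p t * p' t + q t * q' t))).
Proof.
move=> /enorm_gt0; rewrite sqrtr_gt0 /= => n0 dp dq.
have d2 : D (fun s => p s ^+ 2 + q s ^+ 2) t
   ((p' t * p t + p t * p' t) + (q' t * q t + q t * q' t)).
  by apply: has_derivD; apply: has_derivM.
have := has_deriv_comp (B := setT) (fun _ _ => I) d2
  (is_derive_has_deriv _ (is_derive_invsqrt n0)).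
congr (has_deriv _ _ _ _); rewrite /enorm /=; field.
by rewrite gt_eqF// sqrtr_gt0.
Qed.

(** The inverse [w] of the speed satisfies [w' = - w ^ 3 (p p' + q q')], and [p']
    and [q'] are flat when [p - 1] and [q] are; so [w'] lies in the ideal of flat
    functions by induction on the order. *)
Lemma jet_inv_enorm flat k p q : (forall t, t \in `[a, b] -> (p t, q t) != 0) ->
  jet flat k (fun s => p s - 1) -> jet flat k q ->
  jet flat k (fun s => (enorm (p s, q s))^-1 - 1).
Proof.
move=> n0.
have w1 j : jet flat j (fun s => p s - 1) -> jet flat j q ->
    flat -> (enorm (p a, q a))^-1 - 1 = 0.
  move=> jp jq z; have /eqP := jet0 jp z; rewrite subr_eq0 => /eqP ->.
  by rewrite (jet0 jq z) /enorm /= expr0n addr0 expr1n sqrtr1 invr1 subrr.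
elim: k => [|k IH]; first by move=> /w1 /[apply] w0; split.
move=> jp jq; split; first exact: w1 jp jq.
case: (jp) => _ [p' dp jp']; case: (jq) => _ [q' dq jq'].
have {}dp t : t \in `[a, b] -> D p t (p' t).
  move=> tab; have := has_derivD (dp t tab) (has_deriv_cst `[a, b] (1 : R) t).
  by rewrite addr0; apply: has_deriv_ext => // s _; exact: subrK.
exists (fun t => (-1) * ((enorm (p t, q t))^-1 * ((enorm (p t, q t))^-1
     * (enorm (p t, q t))^-1) * (p t * p' t + q t * q' t))).
  move=> t tab; rewrite mulN1r -[X in has_deriv _ _ _ X]addr0.
  apply: has_derivD; last exact: has_deriv_cst.
  by apply: has_deriv_inv_enorm; [exact: n0|exact: dp|exact: dq].
have jw : jet false k (fun t => (enorm (p t, q t))^-1).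
  by apply: (jetDc ab (c := 1)); apply: (jet_weak (flat := flat));
    exact: IH (jetW jp) (jetW jq).
have jp0 : jet false k p by apply: (jetDc ab (c := 1)); exact: jet_weak (jetW jp).
have jq0 : jet false k q by exact: jet_weak (jetW jq).
apply: (jetMl ab); first exact: jet_cst.
apply: (jetMl ab); first by apply: jetM => //; exact: jetM.
by apply: jetD; apply: (jetMl ab).
Qed.

(** For an arc length parametrization this is the condition of the class [inY] at
    the starting point; unlike unit speed, it is inherited by [phi] without any
    change of parameter. *)
Definition flat_start g (p q : R -> R) : Prop :=
  [/\ g a = (0, 0),
      forall t, t \in `[a, b] ->
        [/\ (p t, q t) != 0, D (fst \o g) t (p t) & D (snd \o g) t (q t)],
      forall k, jet true k (fun s => p s - 1) &
      forall k, jet true k q].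

Lemma phiE g p q t : t \in `[a, b] ->
  D (fst \o g) t (p t) -> D (snd \o g) t (q t) ->
  phi a b g t = ((g t).1 + p t * (enorm (p t, q t))^-1 - 1,
                 (g t).2 + q t * (enorm (p t, q t))^-1).
Proof.
move=> tab dp dq; rewrite /phi (has_deriv_derive_in_pair ab tab dp dq).
by congr pair; rewrite /= ?subr0 mulrC.
Qed.

(** [phi] adds to the velocity the derivative of the unit tangent, which is
    orthogonal to the velocity, so that the new velocity does not vanish. *)
Lemma flat_start_phi g p q : flat_start g p q ->
  exists p2 q2, flat_start (phi a b g) p2 q2.
Proof.
move=> [ga dg jp jq]; pose w t := (enorm (p t, q t))^-1.
have aI : a \in `[a, b] by rewrite in_itv/= lexx ltW.
have n0 t : t \in `[a, b] -> (p t, q t) != 0 by case/dg.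
have jw k : jet true k (fun s => w s - 1) by exact: jet_inv_enorm.
have jw0 k : jet false k w by apply: (jetDc ab (c := 1)); exact: jet_weak.
have jK k : jet true k (fun s => p s * w s - 1).
  apply: (jet_ext ab) (jetD (jetM (jp k) (jw0 k)) (jw k)) => // t _.
  by ring.
have jS k : jet true k (fun s => q s * w s) by exact: jetM.
have [K' dK jK'] := jet_deriv ab jK.
have [S' dS jS'] := jet_deriv ab jS.
have E t : t \in `[a, b] ->
    phi a b g t = ((g t).1 + (p t * w t - 1), (g t).2 + q t * w t).
  by move=> tab; have [_ dp dq] := dg t tab; rewrite (phiE tab dp dq) addrA.
have wn t : t \in `[a, b] -> (p t * w t) ^+ 2 + (q t * w t) ^+ 2 = 1.
  move=> /n0/enorm_gt0 e0; rewrite !exprMn -mulrDl exprVn.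
  rewrite sqr_sqrtr ?addr_ge0 ?sqr_ge0// divff// gt_eqF//.
  by move: e0; rewrite sqrtr_gt0.
exists (fun t => p t + K' t), (fun t => q t + S' t); split.
- rewrite E// ga /= (jet0 (jK 0%N))// addr0 (jet0 (jS 0%N)) //.
  by rewrite addr0.
- move=> t tab; have [pq0 dp dq] := dg t tab; split.
  + (* differentiate |unit tangent| ^ 2 = 1 *)
    have orth : (p t * w t) * K' t + (q t * w t) * S' t = 0.
      have dKs : D (fun s => p s * w s) t (K' t).
        have := has_derivD (dK t tab) (has_deriv_cst `[a, b] (1 : R) t).
        by rewrite addr0; apply: has_deriv_ext => // s _; exact: subrK.
      have d1 := has_derivD (has_derivM dKs dKs)
        (has_derivM (dS t tab) (dS t tab)).
      have d0 : D (fun s => p s * w s * (p s * w s) + q s * w s * (q s * w s)) t 0.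
        apply: has_deriv_ext (has_deriv_cst `[a, b] (1 : R) t) => // s sab.
        by rewrite -!expr2 wn.
      have := has_deriv_itv_unique ab tab d1 d0; lra.
    apply: contraNneq pq0 => -[pK qS].
    have e0 : (w t) * (p t ^+ 2 + q t ^+ 2) = 0.
      have -> : w t * (p t ^+ 2 + q t ^+ 2) =
        p t * w t * (p t + K' t) + q t * w t * (q t + S' t) -
        (p t * w t * K' t + q t * w t * S' t) by ring.
      by rewrite orth pK qS !mulr0 addr0 subrr.
    have := wn t tab; rewrite !exprMn -mulrDl mulrC expr2 -mulrA e0 mulr0.
    by move=> /eqP; rewrite eq_sym oner_eq0.
  + apply: has_deriv_ext (has_derivD dp (dK t tab)) => // s sab.
    by rewrite /comp E.
  + apply: has_deriv_ext (has_derivD dq (dS t tab)) => // s sab.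
    by rewrite /comp E.
- move=> k; apply: (jet_ext ab) (jetD (jp k) (jK' k)) => // t _.
  by ring.
- by move=> k; apply: jetD.
Qed.

End UnitTangent.

(** * The maximum principle for the heights *)

Section Barrier.
Set Implicit Arguments.
Unset Strict Implicit.
Context {R : realType}.
Variables (a b : R).
Hypothesis ab : a < b.

Local Notation D := (has_deriv `[a, b]).

(** Only difference quotients from the left are used, so [t = b] is allowed. *)
Lemma has_deriv_max_ge0 (f : R -> R) t l : t \in `]a, b] ->
  (forall s, s \in `[a, b] -> f s <= f t) -> D f t l -> 0 <= l.
Proof.
rewrite in_itv/= => /andP[at_ tb] fmax df.
have sub : `[a, t] `<=` `[a, b] by apply: subset_itvl; rewrite bnd_simp.
have PF : ProperFilter (within `[a, t] t^').
  by apply: within_itv_proper => //; rewrite in_itv/= lexx ltW.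
apply: (cvgr_to_ge (has_deriv_sub sub df)).
have : \forall s \near within `[a, t] t^', `[a, t]%classic s by exact: withinT.
apply: filterS => s ast; have sab : s \in `[a, b] by exact: sub.
move: ast; rewrite /= in_itv/= => /andP[_ st].
by rewrite -mulrNN mulr_ge0// ?oppr_ge0 ?invr_le0 subr_le0//; exact: fmax.
Qed.

Lemma expr2_le_expr3 (n : nat) : 2 ^+ n * (n%:R + 2) <= 2 * 3 ^+ n :> R.
Proof.
elim: n => [|n IH]; first by rewrite !expr0; lra.
rewrite !exprS -natr1.
have : 0 <= 2 ^+ n * n%:R :> R by rewrite mulr_ge0// exprn_ge0.
have : 0 < 2 ^+ n :> R by rewrite exprn_gt0.
lra.
Qed.

Lemma expr2_lt_expr3 (B e : R) : 0 < e ->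
  exists M, forall n, (M <= n)%N -> B * 2 ^+ n < e * 3 ^+ n.
Proof.
move=> e0; exists (Num.truncn (2 * `|B| / e)).+1 => n Mn.
have nB : 2 * `|B| < e * n%:R.
  rewrite [ltRHS]mulrC -ltr_pdivrMr//; apply: lt_le_trans (truncnS_gt _) _.
  by rewrite ler_nat.
have h := expr2_le_expr3 n; have p2 : 0 < 2 ^+ n :> R by rewrite exprn_gt0.
have : e * (2 ^+ n * (n%:R + 2)) <= e * (2 * 3 ^+ n) by rewrite ler_wpM2l// ltW.
have : 2 ^+ n * (2 * `|B|) < 2 ^+ n * (e * n%:R) by rewrite ltr_pM2l.
have : 2 ^+ n * B <= 2 ^+ n * `|B| by rewrite ler_pM2l// ler_norm.
have : 0 < e * 2 ^+ n by exact: mulr_gt0.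
lra.
Qed.

(** The exponent [1/2] is [4] times the slope [1/8] of the bound on the heights. *)
Lemma expR_half_nat (n : nat) : expR (n%:R / 2) <= 2 ^+ n :> R.
Proof.
rewrite mulrC expRM_natr lerXn2r ?nnegrE ?expR_ge0//.
have := expR_ge1Dx (- 2^-1 : R); rewrite expRN => h.
rewrite -lef_pV2 ?posrE ?expR_gt0//; lra.
Qed.

(* [(K n, S n)] is the unit tangent of [(x n, y n)] and [v n] its speed; the tangent
   is abstract so that the same lemmas apply to the mirror images [(x n, - y n)]. *)
Variables (x y K S v : nat -> R -> R).
Hypotheses (x_ge0 : forall n t, t \in `[a, b] -> 0 <= x n t)
  (x0_le1 : forall t, t \in `[a, b] -> x 0%N t <= 1)
  (v_gt0 : forall n t, t \in `[a, b] -> 0 < v n t)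
  (K_ge0 : forall n t, t \in `[a, b] -> 0 <= K n t)
  (KS : forall n t, t \in `[a, b] -> K n t ^+ 2 + S n t ^+ 2 = 1)
  (dx : forall n t, t \in `[a, b] -> D (x n) t (v n t * K n t))
  (dy : forall n t, t \in `[a, b] -> D (y n) t (v n t * S n t))
  (xS : forall n t, t \in `[a, b] -> x n.+1 t = x n t + K n t - 1)
  (yS : forall n t, t \in `[a, b] -> y n.+1 t = y n t + S n t)
  (ya : forall n, y n a <= 0).

(** Since [K ^ 2 + S ^ 2 = 1], a rise [S] exceeds [1/8] by at most [4 (1 - K)],
    and [1 - K] is the decrease of the abscissa; the total decrease is at most 1
    because the abscissas stay in [[0, 1]]. *)
Lemma height_linear_growth :
  exists C, forall n t, t \in `[a, b] -> y n t <= C + n%:R / 8.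
Proof.
have [c _ cmax] := EVT_max (ltW ab) (has_deriv_continuous (@dy 0%N)).
exists (y 0%N c + 4) => n t tab.
suff : y n t + 4 * x n t <= y 0%N t + 4 * x 0%N t + n%:R / 8.
  have := cmax t tab; have := x_ge0 n tab; have := x0_le1 tab; lra.
elim: n => [|n IH]; first by rewrite mul0r addr0.
rewrite xS// yS// -natr1.
have := K_ge0 n tab; have := KS n tab; have := sqr_ge0 (S n t - 4^-1).
have := sqr_ge0 (K n t - 1); nra.
Qed.

(** Let [c] be a point where [e^(4 y_n) - d e^(4 x_n)] is maximal, suppose this
    maximum is at least 1, and put [Q = e^(4 y_n(c))], [u = d e^(4 x_n(c))], so that
    [Q >= 1 + u]. Then [c] is not [a], where the height is not positive, and the sign
    of the derivative at [c] gives [u K <= Q S]. The bound at level [n + 1], where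
    the abscissa is not larger, gives [Q e^(4 S) < 1 + 3 u], hence [4 Q S <= 2 u]. So
    [K] and [S] both lie in [[0, 1/2]], against [K ^ 2 + S ^ 2 = 1]. *)
Lemma barrier_step (d : R) (n : nat) : 0 < d ->
  (forall t, t \in `[a, b] ->
    expR (4 * y n.+1 t) < 1 + 3 * d * expR (4 * x n.+1 t)) ->
  forall t, t \in `[a, b] -> expR (4 * y n t) < 1 + d * expR (4 * x n t).
Proof.
move=> d0 IH.
pose P t := expR (4 * y n t) + (-d) * expR (4 * x n t).
have dexp f f' t : D f t f' -> D (fun s => expR (4 * f s)) t
    (expR (4 * f t) * (4 * f')).
  move=> df; have d4 := has_derivM (has_deriv_cst `[a, b] (4 : R) t) df.
  rewrite mul0r add0r in d4.
  exact: (has_deriv_comp (B := setT) (fun _ _ => I) d4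
    (is_derive_has_deriv setT (is_derive_expR _))).
have dP t : t \in `[a, b] -> D P t (expR (4 * y n t) * (4 * (v n t * S n t))
    + (-d) * (expR (4 * x n t) * (4 * (v n t * K n t)))).
  move=> tab; have hx := dexp _ _ _ (@dx n t tab).
  have := has_derivD (dexp _ _ _ (@dy n t tab))
    (has_derivM (has_deriv_cst `[a, b] (- d) t) hx).
  by rewrite mul0r add0r.
have [c cab cmax] := EVT_max (ltW ab) (has_deriv_continuous dP).
suff Pc : P c < 1 by move=> t tab; have := cmax t tab; rewrite /P in Pc *; lra.
rewrite ltNge; apply/negP => Pc.
have ca : c \in `]a, b].
  rewrite in_itv/= (itvP cab) andbT lt_neqAle (itvP cab) andbT.
  apply/eqP => ac; move: Pc; rewrite -ac /P; apply/negP; rewrite -ltNge.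
  have : expR (4 * y n a) <= 1 by rewrite expR_le1; have := ya n; lra.
  have : 0 < d * expR (4 * x n a) by rewrite mulr_gt0// expR_gt0.
  lra.
have dc := has_deriv_max_ge0 ca cmax (dP c cab).
have := IH c cab; rewrite xS// yS//.
set k := K n c in dc *; set s := S n c in dc *.
set Q := expR (4 * y n c) in Pc dc *; set u := d * expR (4 * x n c).
have u0 : 0 < u by rewrite mulr_gt0// expR_gt0.
have Q1 : 1 + u <= Q by move: Pc; rewrite /P -/Q /u; lra.
have k0 : 0 <= k by exact: K_ge0.
have ks : k ^+ 2 + s ^+ 2 = 1 by exact: KS.
have v0 := v_gt0 n cab.
have {}dc : u * k <= Q * s.
  have : 0 <= (4 * v n c) * (Q * s - u * k) by move: dc; rewrite /u; lra.
  by rewrite pmulr_rge0 ?mulr_gt0// subr_ge0.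
have k1 : k <= 1 by nra.
rewrite mulrDr expRD -/Q -[3 * d * _]mulrA.
have : d * expR (4 * (x n c + k - 1)) <= u.
  by rewrite ler_pM2l// ler_expR; lra.
set u' := d * _ => u'u h.
have h1 : Q * (1 + 4 * s) <= Q * expR (4 * s).
  by rewrite ler_pM2l ?expR_gt0// expR_ge1Dx.
have Qs : 4 * (Q * s) <= 2 * u by lra.
have k2 : k <= 2^-1 by rewrite -(ler_pM2l u0); lra.
have Q0 : 0 < Q by lra.
have s0 : 0 <= s.
  by rewrite -(pmulr_rge0 _ Q0); apply: le_trans dc; rewrite mulr_ge0// ltW.
have s2 : s <= 2^-1 by rewrite -(ler_pM2l Q0); lra.
nra.
Qed.

(** The barrier [1 + d 3^n e^(4 x_n)] dominates [e^(4 y_n)] for large [n], because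
    [y_n] grows at most like [n / 8] and [e^(1/2) <= 2 < 3]; it then dominates
    at level 0 by descending induction, and [d] is arbitrary. *)
Lemma height_le0 t : t \in `[a, b] -> y 0%N t <= 0.
Proof.
move=> tab; have [C HC] := height_linear_growth.
suff main (e : R) : 0 < e -> expR (4 * y 0%N t) <= 1 + e.
  by have : expR (4 * y 0%N t) <= 1; [exact/ler_addgt0Pr | rewrite expR_le1; lra].
move=> e0; pose d := e / expR 4.
have d0 : 0 < d by rewrite divr_gt0// expR_gt0.
have [M HM] := expr2_lt_expr3 (expR (4 * C)) d0.
have large n s : (M <= n)%N -> s \in `[a, b] ->
    expR (4 * y n s) < 1 + d * 3 ^+ n * expR (4 * x n s).
  move=> Mn sab; have := HM _ Mn => h.
  have : expR (4 * y n s) <= expR (4 * C) * 2 ^+ n.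
    apply: (@le_trans _ _ (expR (4 * C) * expR (n%:R / 2))).
      by rewrite -expRD ler_expR; have := HC n s sab; lra.
    by rewrite ler_pM2l ?expR_gt0// expR_half_nat.
  have : d * 3 ^+ n <= d * 3 ^+ n * expR (4 * x n s).
    apply: ler_peMr; first by rewrite mulr_ge0 ?(ltW d0) ?exprn_ge0.
    by rewrite -expR0 ler_expR mulr_ge0// x_ge0.
  lra.
have all k n : (M <= n + k)%N -> forall s, s \in `[a, b] ->
    expR (4 * y n s) < 1 + d * 3 ^+ n * expR (4 * x n s).
  elim: k n => [|k IH] n; first by rewrite addn0 => Mn s; exact: large.
  rewrite addnS -addSn => /IH {}IH; apply: barrier_step.
    by rewrite mulr_gt0// exprn_gt0.
  by move=> s /IH; rewrite exprS mulrCA.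
have := all M 0%N (leq_addl _ _) t tab; rewrite expr0 mulr1 => h.
apply/ltW/(lt_le_trans h); rewrite lerD2l /d -mulrA ger_pMr//.
rewrite ler_pdivrMl ?expR_gt0// mulr1 ler_expR.
by have := x0_le1 tab; lra.
Qed.

End Barrier.

(** * Iterates that are graphs *)

Section FlatStart.
Set Implicit Arguments.
Unset Strict Implicit.
Context {R : realType}.
Variables (a b : R).
Hypothesis ab : a < b.
Implicit Types (f p q : R -> R) (g : R -> R * R) (t l : R).

Local Notation D := (has_deriv `[a, b]).
Local Notation gamma g n := (iter n (phi a b) g).

Lemma flat_start_iter g p q n : flat_start a b g p q ->
  exists pq : (R -> R) * (R -> R), flat_start a b (gamma g n) pq.1 pq.2.
Proof.
move=> fg; elim: n => [|n [pq IH]]; first by exists (p, q).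
by have [p2 [q2 h]] := flat_start_phi ab IH; exists (p2, q2).
Qed.

(** If [p t = 0] the chain rule for [y = f x] gives [q t = 0], which immersion
    excludes; so [p] has a constant sign, that of [p a = 1]. *)
Lemma graph_velocity_gt0 g f p q : flat_start a b g p q ->
  is_smooth_graph a b g f -> forall t, t \in `[a, b] -> 0 < p t.
Proof.
move=> [_ dg jp _] [sf gf].
have aI : a \in `[a, b] by rewrite in_itv/= lexx ltW.
have pn0 t : t \in `[a, b] -> p t != 0.
  move=> tab; have [pq0 dp dq] := dg t tab; have [x01 _] := gf t tab.
  have [m dfm] : exists m, has_deriv `[0, 1] f (g t).1 m.
    by have /cvgP := sf 0%N _ x01; exists (derive_in 0 1 f (g t).1).
  have AB s : `[a, b]%classic s -> `[0, 1]%classic ((fst \o g) s).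
    by move=> /gf[].
  have dq2 : D (snd \o g) t (m * p t).
    by apply: has_deriv_ext (has_deriv_comp AB dp dfm) => // s /gf[_ /= ->].
  apply: contraNneq pq0 => p0; rewrite p0 xpair_eqE eqxx/=.
  by rewrite (has_deriv_itv_unique ab tab dq dq2) p0 mulr0.
have pa : p a = 1 by apply/eqP; rewrite -subr_eq0; apply/eqP/(jet0 (jp 0%N)).
have [_ [p' dp' _]] := jp 1%N.
have cp : {within `[a, b], continuous p}.
  apply: (@has_deriv_continuous _ _ _ _ p') => t tab.
  have := has_derivD (dp' t tab) (has_deriv_cst `[a, b] (1 : R) t).
  by rewrite addr0; apply: has_deriv_ext => // s _; exact: subrK.
move=> t tab; rewrite ltNge; apply/negP => pt.
have sub : `[a, t] `<=` `[a, b] by apply: subset_itvl; rewrite bnd_simp (itvP tab).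
have [|||c cat pc] := @IVT R p a t 0.
- by rewrite (itvP tab).
- exact: continuous_subspaceW cp.
- by rewrite pa ge_min le_max pt ler01 orbT.
by have := pn0 c (sub _ cat); rewrite pc eqxx.
Qed.

(** The upper bound on heights, applied to the curves and to their mirror images
    in the horizontal axis. *)
Lemma graph_iterates_height g p q : flat_start a b g p q ->
  (forall n, exists f, is_smooth_graph a b (gamma g n) f) ->
  forall t, t \in `[a, b] -> (g t).2 = 0.
Proof.
move=> fg graph t tab.
have /choice[pq fgn] n := flat_start_iter n fg.
pose e n s := enorm ((pq n).1 s, (pq n).2 s).
have e0 n s : s \in `[a, b] -> 0 < e n s.
  by move=> sab; apply: enorm_gt0; have [_ /(_ s sab)[]] := fgn n.
have Kge0 n s : s \in `[a, b] -> 0 <= (pq n).1 s / e n s.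
  move=> sab; rewrite divr_ge0//; last exact/ltW/e0.
  by have [f gf] := graph n; apply/ltW/(graph_velocity_gt0 (fgn n) gf).
have KS n s : s \in `[a, b] -> ((pq n).1 s / e n s) ^+ 2 + ((pq n).2 s / e n s) ^+ 2 = 1.
  move=> /(e0 n) es; rewrite !exprMn -mulrDl exprVn.
  rewrite sqr_sqrtr ?addr_ge0 ?sqr_ge0// divff// gt_eqF//.
  by move: es; rewrite sqrtr_gt0.
have x01 n s : s \in `[a, b] -> 0 <= (gamma g n s).1 <= 1.
  by have [f [_ gf]] := graph n => /gf[]; rewrite in_itv.
have phin n s : s \in `[a, b] -> gamma g n.+1 s =
    ((gamma g n s).1 + (pq n).1 s / e n s - 1, (gamma g n s).2 + (pq n).2 s / e n s).
  by move=> sab; have [_ /(_ s sab)[_ dp dq] _ _] := fgn n; exact: phiE.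
have ga n : gamma g n a = (0, 0) by have [] := fgn n.
have dx n s : s \in `[a, b] ->
    D (fst \o gamma g n) s (e n s * ((pq n).1 s / e n s)).
  move=> sab; have [_ /(_ s sab)[_ dp _] _ _] := fgn n.
  by rewrite mulrC divfK// gt_eqF// e0.
have dy n s : s \in `[a, b] ->
    D (snd \o gamma g n) s (e n s * ((pq n).2 s / e n s)).
  move=> sab; have [_ /(_ s sab)[_ _ dq] _ _] := fgn n.
  by rewrite mulrC divfK// gt_eqF// e0.
apply/eqP; rewrite eq_le; apply/andP; split.
- apply: (height_le0 ab (x := fun n => fst \o gamma g n)
    (y := fun n => snd \o gamma g n) (v := e) (K := fun n s => (pq n).1 s / e n s)
    (S := fun n s => (pq n).2 s / e n s)) tab => //.
  + by move=> n s /(x01 n)/andP[].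
  + by move=> s /(x01 0%N)/andP[].
  + by move=> n s sab; rewrite /comp phin.
  + by move=> n s sab; rewrite /comp phin.
  + by move=> n /=; rewrite -/(gamma g n) ga.
- rewrite -oppr_le0.
  apply: (height_le0 ab (x := fun n => fst \o gamma g n)
    (y := fun n s => - (gamma g n s).2) (v := e) (K := fun n s => (pq n).1 s / e n s)
    (S := fun n s => - ((pq n).2 s / e n s))) tab => //.
  + by move=> n s /(x01 n)/andP[].
  + by move=> s /(x01 0%N)/andP[].
  + by move=> n s sab; rewrite sqrrN KS.
  + move=> n s sab.
    have := has_derivM (has_deriv_cst `[a, b] (-1 : R) s) (dy n s sab).
    rewrite mul0r add0r mulN1r -mulrN; apply: has_deriv_ext => // u _.
    exact: mulN1r.
  + by move=> n s sab; rewrite /comp phin.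
  + by move=> n s sab; rewrite phin// opprD.
  + by move=> n; rewrite ga /= oppr0.
Qed.

(** Once the heights vanish the unit tangent is [(1, 0)], and [phi] fixes the
    curve. *)
Lemma graph_iterates_fixed g p q : flat_start a b g p q ->
  (forall n, exists f, is_smooth_graph a b (gamma g n) f) ->
  forall n t, t \in `[a, b] -> gamma g n t = ((g t).1, 0).
Proof.
move=> fg graph.
have y0 n t : t \in `[a, b] -> (gamma g n t).2 = 0.
  have [pq fgn] := flat_start_iter n fg.
  by apply: (graph_iterates_height fgn) => m; rewrite -iterD; exact: graph.
elim=> [|n IH] t tab.
  by rewrite -(y0 0%N t tab) /=; case: (g t).
have [[p1 q1] /= fgn] := flat_start_iter n fg.
have [_ /(_ t tab)[_ dp dq] _ _] := fgn.
have [f gf] := graph n.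
have p0 := graph_velocity_gt0 fgn gf tab.
have q0 : q1 t = 0.
  apply: (has_deriv_itv_unique ab tab dq).
  by apply: has_deriv_ext (has_deriv_cst `[a, b] (0 : R) t) => // s sab; rewrite /= y0.
rewrite (phiE ab tab dp dq) IH// q0 mul0r addr0.
rewrite /enorm /= expr0n addr0 sqrtr_sqr gtr0_norm// divff ?gt_eqF//.
by rewrite addrK.
Qed.

End FlatStart.

(** * Primitives and inverse functions on a segment *)

Section Primitive.
Set Implicit Arguments.
Unset Strict Implicit.
Context {R : realType}.

(** The integrand is extended by its end values, so that the endpoints become
    interior points of the fundamental theorem of calculus. *)
Lemma primitive_on_itv (a b : R) (v : R -> R) : a < b ->
  {within `[a, b], continuous v} ->
  exists F : R -> R, forall t, t \in `[a, b] -> is_derive t (1 : R) F (v t) /\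
    \int[lebesgue_measure]_(u in `[a, t]) v u = F t - F a.
Proof.
move=> ab cv; pose c (t : R) : R := Num.max a (Num.min b t).
have cI t : t \in `[a, b] -> c t = t.
  by rewrite in_itv/= => /andP[at_ tb]; rewrite /c (min_idPr tb) (max_idPr at_).
have cab t : c t \in `[a, b].
  by rewrite in_itv/= /c le_max lexx/= ge_max (ltW ab)/= ge_min lexx.
pose V := v \o c.
have cc : continuous c.
  move=> t; apply: continuous_max; first exact: cvg_cst.
  by apply: continuous_min; [exact: cvg_cst|exact: cvg_id].
have cV : continuous V.
  move=> t U Ut; have /subspace_continuousP/(_ (c t) (cab t) U Ut) := cv.
  move=> /(cc t); rewrite /nbhs /= /within /=.
  by apply: (@filterS _ (nbhs t)) => s; apply; exact: cab.
have iV (x y : R) : lebesgue_measure.-integrable `[x, y] (EFin \o V).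
  apply: continuous_compact_integrable; first exact: segment_compact.
  exact: continuous_subspaceT.
exists (fun x => \int[lebesgue_measure]_(u in `[a - 1, x]) V u) => t tab.
have a1t : a - 1 < t by rewrite (@lt_le_trans _ _ a) ?ltrBlDr ?ltrDl// (itvP tab).
split.
  have [|dF dFE] := @continuous_FTC1_closed R V (a - 1) t (t + 1) _ (iV _ _) a1t (cV t).
    by rewrite ltrDl.
  have -> : v t = V t by rewrite /V /= cI.
  by rewrite -dFE derive1E; exact: derivableP.
rewrite Rintegral_itvB ?bnd_simp; [|exact: iV|lra|by rewrite (itvP tab)].
rewrite Rintegral_itv_obnd_cbnd; last first.
  by apply: integrableS (iV a t) => //; apply: subset_itvr; rewrite bnd_simp.
apply: eq_Rintegral => u /set_mem; rewrite /= in_itv/= => /andP[au ut].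
by rewrite /V /= cI// in_itv/= au (le_trans ut)// (itvP tab).
Qed.

(** The difference quotient of [h] is the inverse of that of [f], composed
    with [h]. *)
Lemma has_deriv_inverse (A B : set R) (f h : R -> R) t l : l != 0 ->
  (forall u, B u -> A (h u)) -> (forall u, B u -> f (h u) = u) -> h (f t) = t ->
  h @ within B (nbhs (f t)) --> h (f t) ->
  has_deriv A f t l -> has_deriv B h (f t) l^-1.
Proof.
move=> l0 BA fh hft ch df.
pose w y := if y == t then l else (y - t)^-1 * (f y - f t).
have cw : w @ within A (nbhs t) --> l.
  apply: within_dnbhs_nbhs; last by rewrite /w eqxx.
  apply: cvg_trans df; apply: near_eq_cvg; near=> y.
  have -> : w y = (y - t)^-1 * (f y - f t) => //.
  rewrite /w ifF//; apply/negbTE.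
  by near: y; exact: within_dnbhs_neq.
have cwh : (w \o h) @ within B (f t)^' --> l.
  apply: within_nbhs_dnbhs; move=> U /cw nU.
  rewrite hft in ch; have := ch _ nU; rewrite /= /nbhs /= /within /=.
  by apply: (@filterS _ (nbhs (f t))) => u + Bu => /(_ Bu); apply; exact: BA.
apply: cvg_trans (cvgV l0 cwh); apply: near_eq_cvg; near=> u.
have Bu : B u by near: u; exact: withinT.
have ut : u != f t by near: u; exact: within_dnbhs_neq.
have hut : h u != t by apply: contraNneq ut => <-; rewrite fh.
by rewrite /= /w (negbTE hut) fh// hft invfM invrK mulrC.
Unshelve. all: by end_near. Qed.

End Primitive.

(** * Reduction to arc length *)

Section SmoothCurves.
Set Implicit Arguments.
Unset Strict Implicit.
Context {R : realType}.
Variables (a b : R).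
Hypothesis ab : a < b.
Implicit Types (g : R -> R * R).

Lemma jet_derive_inn (flat : bool) m g :
  (forall j t, t \in `[a, b] -> cvg (dquot_in a b (derive_inn a b j g) t)) ->
  (flat -> forall j, (m <= j)%N -> derive_inn a b j g a = 0) ->
  forall k j, (m <= j)%N ->
    @jet R a b flat k (fst \o derive_inn a b j g) /\
    @jet R a b flat k (snd \o derive_inn a b j g).
Proof.
move=> cg g0; elim=> [|k IH] j mj.
  by split; split => // z; rewrite /comp g0.
have [j1 j2] := IH j.+1 (leqW mj).
split; split; try (by move=> z; rewrite /comp g0).
- exists (fst \o derive_inn a b j.+1 g) => // t tab.
  by have [] := cvg_dquot_has_deriv ab tab (cg j t tab).
- exists (snd \o derive_inn a b j.+1 g) => // t tab.
  by have [] := cvg_dquot_has_deriv ab tab (cg j t tab).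
Qed.

Lemma jet_cvg_derive_inn g : (forall k, @jet R a b false k (fst \o g)) ->
  (forall k, @jet R a b false k (snd \o g)) ->
  forall j t, t \in `[a, b] -> cvg (dquot_in a b (derive_inn a b j g) t).
Proof.
move=> j1 j2 j.
have [{}j1 {}j2] : (forall k, @jet R a b false k (fst \o derive_inn a b j g)) /\
    (forall k, @jet R a b false k (snd \o derive_inn a b j g)).
  elim: j => [|j [IH1 IH2]] //.
  have [p dp jp] := jet_deriv ab IH1; have [q dq jq] := jet_deriv ab IH2.
  have E t : t \in `[a, b] -> derive_inn a b j.+1 g t = (p t, q t).
    by move=> tab; apply: (has_deriv_derive_in_pair ab tab); [exact: dp|exact: dq].
  by split => k; [apply: (jet_ext ab) (jp k)|apply: (jet_ext ab) (jq k)] => t tab;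
    rewrite /comp E.
have [p dp _] := jet_deriv ab j1; have [q dq _] := jet_deriv ab j2.
move=> t tab; apply/cvg_ex; exists (p t, q t).
by apply: has_deriv_cvg_dquot => //; [exact: dp|exact: dq].
Qed.

(** The derivative of [f \o h] is [(f' * r) \o h], of the same form. *)
Lemma jet_comp (c d : R) (h r : R -> R) :
  (forall u, u \in `[c, d] -> h u \in `[a, b]) ->
  (forall u, u \in `[c, d] -> has_deriv `[c, d] h u (r (h u))) ->
  (forall k, @jet R a b false k r) ->
  forall k f, @jet R a b false k f -> @jet R c d false k (f \o h).
Proof.
move=> hI dh jr; elim=> [|k IH] f; first by split.
move=> [_ [f' df jf']]; split => //.
exists ((fun t => f' t * r t) \o h); last by apply: IH; exact: jetM.
move=> u ucd; exact: has_deriv_comp (hI : forall s, `[c, d]%classic s -> _)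
  (dh u ucd) (df _ (hI u ucd)).
Qed.

End SmoothCurves.

Section ArcLength.
Set Implicit Arguments.
Unset Strict Implicit.
Context {R : realType}.
Variables (a b : R) (g : R -> R * R).
Hypothesis gY : inY a b g.

Let ab : a < b := inY_lt gY.
Let p := fst \o derive_in a b g.
Let q := snd \o derive_in a b g.
Let v t := enorm (derive_in a b g t).
Let s := arclen a b g.
Let L := s b.
Let h := 'pinv_(fun=> a) `[a, b] s.
Let G := arcparam a b g.

Let aI : a \in `[a, b]. Proof. by rewrite in_itv/= lexx ltW. Qed.
Let bI : b \in `[a, b]. Proof. by rewrite in_itv/= lexx ltW. Qed.

Let jet_g k j : @jet R a b false k (fst \o derive_inn a b j g) /\
  @jet R a b false k (snd \o derive_inn a b j g).
Proof.
by apply: (jet_derive_inn (m := 0%N) ab) => // i t; case: (inY_immersed gY) => + _; apply.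
Qed.

Let dg t : t \in `[a, b] ->
  has_deriv `[a, b] (fst \o g) t (p t) /\ has_deriv `[a, b] (snd \o g) t (q t).
Proof.
move=> tab; apply: cvg_dquot_has_deriv => //.
by case: (inY_immersed gY) => /(_ 0%N t tab).
Qed.

Let pq0 t : t \in `[a, b] -> (p t, q t) != 0.
Proof.
move=> tab; case: (inY_immersed gY) => _ /(_ t tab).
by rewrite /p /q /=; case: (derive_in a b g t).
Qed.

Let vE t : v t = enorm (p t, q t).
Proof. by rewrite /v /p /q /=; case: (derive_in a b g t). Qed.

Let v_gt0 t : t \in `[a, b] -> 0 < v t.
Proof. by move=> /pq0/enorm_gt0; rewrite vE. Qed.

Let jet_vV k : @jet R a b false k (fun t => (v t)^-1).
Proof.
apply: (jetDc ab (c := 1)).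
apply: (jet_ext ab (f := fun t => (enorm (p t, q t))^-1 - 1)).
  by move=> t _; rewrite vE.
apply: jet_inv_enorm => //.
- by apply: (jetD (jet_g k 1).1 (jet_cst a b k (-1))).
- exact: (jet_g k 1).2.
Qed.

Let v_continuous : {within `[a, b], continuous v}.
Proof.
have [_ [r' dr _]] := jet_vV 1.
apply/subspace_continuousP => t tab.
have vV0 : (v t)^-1 != 0 by rewrite invr_eq0 gt_eqF// v_gt0.
have cV := @cvgV _ _ (within `[a, b] (nbhs t)) _ _ _ vV0 (has_deriv_cvg (dr t tab)).
suff : v @ within `[a, b] (nbhs t) --> v t by [].
have -> : v = (fun x => (v x)^-1^-1) by apply/funext => x; rewrite invrK.
exact: cV.
Qed.

Let s_facts : exists F : R -> R, forall t, t \in `[a, b] ->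
  is_derive t (1 : R) F (v t) /\ s t = F t - F a.
Proof. exact: primitive_on_itv. Qed.

Let sa0 : s a = 0.
Proof. by have [F /(_ a aI)[_ ->]] := s_facts; rewrite subrr. Qed.

Let ds t : t \in `[a, b] -> has_deriv `[a, b] s t (v t).
Proof.
move=> tab; have [F HF] := s_facts; have [dF _] := HF t tab.
have := has_derivD (is_derive_has_deriv `[a, b] dF) (has_deriv_cst `[a, b] (- F a) t).
by rewrite addr0; apply: has_deriv_ext => // u /HF[_ ->].
Qed.

Let s_lt : {in `[a, b] &, {homo s : x y / x < y}}.
Proof.
have [F HF] := s_facts; move=> x y xab yab xy.
rewrite (HF x xab).2 (HF y yab).2 ltrD2r.
have sub t : t \in `]a, b[ -> t \in `[a, b] by apply: subset_itv_oo_cc.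
apply: (@gtr0_derive1_lt_cc R F a b) => //.
- by move=> t /sub/HF[[]].
- by move=> t /sub tab; rewrite derive1E (@derive_val _ _ _ _ _ _ _ (HF t tab).1) v_gt0.
- apply: (@has_deriv_continuous _ _ _ _ v) => t /HF[dF _].
  exact: is_derive_has_deriv.
Qed.

Let s_inj : {in `[a, b]%classic &, injective s}.
Proof.
move=> x y /set_mem xab /set_mem yab sxy.
by case: (ltgtP x y) => // xy; [have := s_lt xab yab xy|have := s_lt yab xab xy];
  rewrite sxy ltxx.
Qed.

Let hs t : t \in `[a, b] -> h (s t) = t.
Proof.
move=> tab.
exact: (@pinvKV R R (fun=> a) `[a, b]%classic s s_inj t (mem_set tab)).
Qed.

Let L_gt0 : 0 < L.
Proof. by rewrite -sa0; exact: s_lt. Qed.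

Let s_continuous : {within `[a, b], continuous s}.
Proof. by apply: (@has_deriv_continuous _ _ _ _ v) => t; exact: ds. Qed.

Let s_itv t : t \in `[a, b] -> s t \in `[0, L].
Proof.
move=> tab; rewrite in_itv/= -sa0.
have [at_ tb] : a <= t /\ t <= b by rewrite !(itvP tab).
apply/andP; split.
  by move: at_; rewrite (le_eqVlt a t) => /orP[/eqP <-//|at_]; exact/ltW/s_lt.
by move: tb; rewrite (le_eqVlt t b) => /orP[/eqP ->//|tb]; exact/ltW/s_lt.
Qed.

Let s_onto u : u \in `[0, L] -> exists2 t, t \in `[a, b] & u = s t.
Proof.
rewrite in_itv/= => /andP[u0 uL].
have [|t tab st] := @IVT R s a b u (ltW ab) s_continuous.
  by rewrite sa0 -/L ge_min u0 le_max uL orbT.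
by exists t.
Qed.

Let dh t : t \in `[a, b] -> has_deriv `[0, L] h (s t) (v t)^-1.
Proof.
move=> tab; apply: (has_deriv_inverse (A := `[a, b]) (f := s)).
- by rewrite gt_eqF// v_gt0.
- by move=> u /s_onto[r rab ->]; rewrite hs.
- by move=> u /s_onto[r rab ->]; rewrite hs.
- exact: hs.
- have : {within `[(s a), (s b)], continuous h}.
    exact: (segment_can_le_continuous (ltW ab) s_continuous hs).
  by rewrite sa0 => /subspace_continuousP; apply; exact: s_itv.
- exact: ds.
Qed.

Let Gs t : t \in `[a, b] -> G (s t) = g t.
Proof. by move=> tab; have -> : G (s t) = g (h (s t)) by []; rewrite hs. Qed.

Let dG t : t \in `[a, b] ->
  has_deriv `[0, L] (fst \o G) (s t) (p t * (v t)^-1) /\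
  has_deriv `[0, L] (snd \o G) (s t) (q t * (v t)^-1).
Proof.
move=> tab; have [dp dq] := dg tab.
rewrite -{1}(hs tab) in dp; rewrite -{1}(hs tab) in dq.
have hI u : `[0, L]%classic u -> `[a, b]%classic (h u).
  by move=> /s_onto[r rab ->]; rewrite hs.
by split; [exact: has_deriv_comp hI (dh tab) dp | exact: has_deriv_comp hI (dh tab) dq].
Qed.

Let G_smooth j u : u \in `[0, L] -> cvg (dquot_in 0 L (derive_inn 0 L j G) u).
Proof.
have jc k f : @jet R a b false k f -> @jet R 0 L false k (f \o h).
  apply: jet_comp jet_vV k f => {}u /s_onto[t tab ->]; first by rewrite hs.
  by rewrite hs//; exact: dh.
apply: jet_cvg_derive_inn => // k.
  exact: (jc _ _ (jet_g k 0).1).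
exact: (jc _ _ (jet_g k 0).2).
Qed.

(** The arc length parametrization turns the conditions at the starting point into
    conditions on plain derivatives. *)
Lemma arcparam_flat_start : flat_start 0 L G
  (fst \o derive_in 0 L G) (snd \o derive_in 0 L G).
Proof.
have jG (k : nat) := @jet_derive_inn _ _ _ L_gt0 true 2 G G_smooth
  (fun _ => inY_flat_start gY) k 2 (leqnn 2).
have t1 : derive_in 0 L G 0 = (1, 0) := inY_tangent_start gY.
have u0 : 0 \in `[0, L] by rewrite in_itv/= lexx ltW.
have dG1 u : u \in `[0, L] -> has_deriv `[0, L] (fst \o derive_in 0 L G) u
     ((fst \o derive_inn 0 L 2 G) u) /\
    has_deriv `[0, L] (snd \o derive_in 0 L G) u ((snd \o derive_inn 0 L 2 G) u).
  by move=> uL; exact: (cvg_dquot_has_deriv L_gt0 uL (@G_smooth 1 u uL)).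
split.
- by rewrite -[in G _]sa0 Gs// (inY_start gY).
- move=> u /[dup] uL /s_onto[t tab ut].
  have [d1 d2] := cvg_dquot_has_deriv L_gt0 uL (@G_smooth 0 u uL).
  split => //=; have [e1 e2] := dG tab; rewrite -ut in e1 e2.
  rewrite (has_deriv_itv_unique L_gt0 uL d1 e1) (has_deriv_itv_unique L_gt0 uL d2 e2).
  apply: contraNneq (pq0 tab) => -[/eqP + /eqP].
  have v0 : ((v t)^-1 == 0) = false by rewrite invr_eq0 gt_eqF ?v_gt0.
  rewrite !mulf_eq0 v0 !orbF => /eqP -> /eqP ->.
  exact: eqxx.
- case=> [|k]; first by split => // _; rewrite /= t1 subrr.
  split => [_|]; first by rewrite /= t1 subrr.
  exists (fst \o derive_inn 0 L 2 G); last by have [] := jG k.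
  move=> u /dG1[d _]; have := has_derivD d (has_deriv_cst `[0, L] (-1 : R) u).
  by rewrite addr0.
- case=> [|k]; first by split => // _; rewrite /= t1.
  split => [_|]; first by rewrite /= t1.
  exists (snd \o derive_inn 0 L 2 G); last by have [] := jG k.
  by move=> u /dG1[].
Qed.

(** [phi] is geometric: the factor [v t] between the two velocities cancels in
    the unit tangent. *)
Lemma iter_phi_arcparam n t : t \in `[a, b] ->
  iter n (phi a b) g t = iter n (phi 0 L) G (s t).
Proof.
elim: n t => [|n IH] t tab; first by rewrite /= Gs.
have [[P Q] /= [_ dPQ _ _]] := flat_start_iter L_gt0 n arcparam_flat_start.
have [PQ0 dP dQ] := dPQ (s t) (s_itv tab).
have sI u : `[a, b]%classic u -> `[0, L]%classic (s u) by exact: s_itv.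
have ext (pr : R * R -> R) l : has_deriv `[0, L] (pr \o iter n (phi 0 L) G) (s t) l ->
    has_deriv `[a, b] (pr \o iter n (phi a b) g) t (l * v t).
  move=> dl; apply: has_deriv_ext (has_deriv_comp sI (ds tab) dl) => // u uab.
  by rewrite /comp IH.
rewrite (phiE ab tab (p := fun=> P (s t) * v t) (q := fun=> Q (s t) * v t)
  (ext _ _ dP) (ext _ _ dQ)).
rewrite (phiE L_gt0 (s_itv tab) dP dQ) IH//.
have -> : enorm (P (s t) * v t, Q (s t) * v t) = enorm (P (s t), Q (s t)) * v t.
  rewrite /enorm /= !exprMn -mulrDl sqrtrM ?addr_ge0 ?sqr_ge0// sqrtr_sqr.
  by rewrite gtr0_norm// v_gt0.
have e0 := enorm_gt0 PQ0; have v0 := v_gt0 tab.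
by rewrite !invfM -!mulrA !(mulrCA (v t)) divff ?gt_eqF// !mulr1.
Qed.

Lemma graph_iterates_segment :
  (forall n, exists f, is_smooth_graph a b (iter n (phi a b) g) f) ->
  forall n t, t \in `[a, b] -> iter n (phi a b) g t = ((g t).1, 0).
Proof.
move=> graph n t tab; rewrite iter_phi_arcparam// -[in RHS]Gs//.
apply: (graph_iterates_fixed L_gt0 arcparam_flat_start) (s_itv tab) => m.
have [f [sf gf]] := graph m; exists f; split => // u /s_onto[r rab ->].
by rewrite -iter_phi_arcparam//; exact: gf.
Qed.

Lemma abscissa_onto x : x \in `[0, 1] -> exists2 t, t \in `[a, b] & (g t).1 = x.
Proof.
rewrite in_itv/= => /andP[x0 x1].
have cg : {within `[a, b], continuous (fst \o g)}.
  by apply: (@has_deriv_continuous _ _ _ _ p) => t /dg[].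
apply: (IVT (ltW ab) cg).
by rewrite /= (inY_start gY) (inY_end gY) /= ge_min x0 le_max x1 orbT.
Qed.

End ArcLength.

Theorem theorem4p2 (R : realType) (a b : R) (g0 : R -> R * R)
    (hY : inY a b g0) :
  (forall f : nat -> R -> R,
     (forall n : nat, is_smooth_graph a b (iter n (phi a b) g0) (f n)) ->
     forall (n : nat) (x : R), x \in `[0, 1] -> f n x = 0) /\
  (g0 @` `[a, b] <> segment01 ->
   ~ forall n : nat, exists f : R -> R,
       is_smooth_graph a b (iter n (phi a b) g0) f).
Proof.
split.
  move=> f gf n x /(abscissa_onto hY)[t tab <-].
  have gn : iter n (phi a b) g0 t = ((g0 t).1, 0).
    by apply: graph_iterates_segment tab => // m; exists (f m).
  by have [_ /(_ t tab)[_]] := gf n; rewrite gn.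
move=> im graph; apply: im; apply/seteqP; split.
  move=> _ [t tab <-]; exists (g0 t).1.
    by have [f [_ /(_ t tab)[]]] := graph 0%N.
  by rewrite -(graph_iterates_segment hY graph 0 tab).
move=> _ [x x01 <-]; have [t tab <-] := abscissa_onto hY x01.
by exists t => //; rewrite -(graph_iterates_segment hY graph 0 tab).
Qed.
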